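(* Let $S$ and $T$ be numerical semigroups. Then $T$ is an over-semigroup of $S$ if and only if $T$ is an idempotent element of $\mathcal{I}_0(S)$.
   Context: $\mathbb{N}$ denotes the non-negative integers. A numerical semigroup is a submonoid of $(\mathbb{N},+)$ with finite complement in $\mathbb{N}$. A numerical semigroup $T$ is an over-semigroup of $S$ if $S\subseteq T$. $\mathcal{I}_0(S)=\{E\subseteq\mathbb{N}: E+S\subseteq E,\ \min(E)=0\}$ is the set of ideals of $S$ with minimum $0$; it is a commutative monoid under $I+J=\{a+b: a\in I, b\in J\}$, with identity $S$. An element $I\in\mathcal{I}_0(S)$ is idempotent if $I+I=I$. *)

(* Defs.v *)
From mathcomp Require Import all_boot all_order.
From mathcomp Require Import boolp classical_sets functions cardinality.

Set Implicit Arguments.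
Unset Strict Implicit.
Unset Printing Implicit Defensive.

Local Open Scope classical_set_scope.

Definition sumset (I J : set nat) : set nat :=
  [set (a + b)%N | a in I & b in J].

Definition numerical_semigroup (S : set nat) : Prop :=
  [/\ S 0%N,
      forall a b : nat, S a -> S b -> S (a + b)%N
    & finite_set (~` S)].

Definition over_semigroup (S T : set nat) : Prop :=
  numerical_semigroup T /\ S `<=` T.

(* [A 0 /\ lbound A 0] says that 0 is the minimum of A; the second conjunct is
   automatic for sets of natural numbers. *)
Definition ideals0 (S : set nat) : set (set nat) :=
  [set E | sumset E S `<=` E /\ (E 0%N /\ lbound E 0%N)].

Definition idempotent_ideal0 (S I : set nat) : Prop :=
  ideals0 S I /\ sumset I I = I.

(* For a numerical semigroup S, [ideals0 S] is a commutative monoid under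
   [sumset], with identity S. *)
Lemma sumsetC : commutative sumset.
Proof.
by move=> I J; apply/seteqP; split=> _ [a Ia [b Jb <-]]; exists b => //;
  exists a => //; rewrite addnC.
Qed.

Lemma sumsetA : associative sumset.
Proof.
move=> I J K; apply/seteqP; split=> x.
  move=> [a Ia [_ [b Jb [c Kc <-]] <-]]; exists (a + b)%N; last first.
    by exists c => //; rewrite addnA.
  by exists a => //; exists b.
move=> [_ [a Ia [b Jb <-]] [c Kc <-]]; exists a => //.
by exists (b + c)%N; [exists b => //; exists c | rewrite addnA].
Qed.

Lemma ideals0D (S I J : set nat) :
  ideals0 S I -> ideals0 S J -> ideals0 S (sumset I J).
Proof.
move=> [_ [I0 _]] [JS [J0 _]]; split; last first.
  by split=> //; exists 0%N => //; exists 0%N.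
rewrite -sumsetA => _ [a Ia [b /JS Jb <-]].
by exists a => //; exists b.
Qed.

Lemma ideals0_id (S : set nat) : numerical_semigroup S -> ideals0 S S.
Proof.
by move=> [S0 SD _]; split=> // _ [a Sa [b Sb <-]]; apply: SD.
Qed.

Lemma sumset_id (S I : set nat) :
  numerical_semigroup S -> ideals0 S I -> sumset I S = I.
Proof.
move=> [S0 _ _] [IS _]; apply/seteqP; split=> // a Ia.
by exists a => //; exists 0%N => //; rewrite addn0.
Qed.

(* Main.v *)
Require Import Defs.
From mathcomp Require Import all_boot all_order.
From mathcomp Require Import boolp classical_sets functions cardinality.

(** Closure of [T] under addition turns [S] ⊆ [T] into [T] + [S] ⊆ [T] + [T] ⊆ [T]. Conversely,
    since 0 lies in [T], any ideal condition [T] + [S] ⊆ [T] forces [S] = 0 + [S] ⊆ [T]. *)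

Theorem proposition5p13 (S T : set nat)
    (hS : numerical_semigroup S) (hT : numerical_semigroup T) :
  over_semigroup S T <-> idempotent_ideal0 S T.
Proof.
have [T0 TD _] := hT; split=> [[_ ST] | [[TS _] _]].
  (* Idempotence: [T] is the identity of its own ideal monoid [ideals0 T], hence [T] + [T] = [T]. *)
  split; last exact: sumset_id hT (ideals0_id hT).
  split=> [_ [a Ta [b /ST Tb <-]]|]; first exact: TD.
  by split=> // n _.
split=> // s Ss; apply: TS.
(* Write [s] as 0 + [s] with 0 in [T]. *)
by exists 0%N => //; exists s.
Qed.
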